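(* Let $H\in\mathbb{C}^{n\times n}$ be an arbitrary non-singular Hermitian matrix and let $\eta\in(1,\infty]$ be arbitrary. Then $$\mathcal{C}(\mathbf{S}_H(\eta))=\mathbf{L}_H(\eta),$$ where the Cayley transform is considered wherever it is well defined; that is, $\mathcal{C}$ maps $\{A\in\mathbf{S}_H(\eta):-1\notin\mathrm{spec}(A)\}$ onto $\{A\in\mathbf{L}_H(\eta):-1\notin\mathrm{spec}(A)\}$.
   Context: For Hermitian matrices, $M\succ N$ means $M-N$ is positive definite. For a non-singular Hermitian $H\in\mathbb{C}^{n\times n}$ and $\eta\in(1,\infty]$, $$\mathbf{S}_H(\eta)=\{A\in\mathbb{C}^{n\times n}:\tfrac{\eta-1}{\eta+1}H-A^*HA\succ 0\},$$ $$\mathbf{L}_H(\eta)=\{A\in\mathbb{C}^{n\times n}:HA+A^*H\succ\tfrac1\eta(A^*HA+H)\},$$ where for $\eta=\infty$ one reads $\frac{\eta-1}{\eta+1}=1$ and $\frac1\eta=0$. The Cayley transform of $A\in\mathbb{C}^{n\times n}$ with $-1\notin\mathrm{spec}(A)$ is $\mathcal{C}(A)=(I_n-A)(I_n+A)^{-1}$. *)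

(* Defs.v *)
From mathcomp Require Import all_boot all_order all_algebra.
From mathcomp Require Import sesquilinear spectral complex.
From mathcomp Require Import classical_sets reals constructive_ereal.

Set Implicit Arguments.
Unset Strict Implicit.
Unset Printing Implicit Defensive.

Import Order.TTheory GRing.Theory Num.Theory.

Local Open Scope ring_scope.
Local Open Scope complex_scope.
Local Open Scope sesquilinear_scope.
Local Open Scope classical_set_scope.

Section Disks.
Context {R : realType} {n : nat}.
Implicit Types (A H M N : 'M[R[i]]_n) (eta : \bar R).

(* On R[i], [0 < z] says that z is real and positive. *)
Definition posdefmx M : Prop :=
  M \is hermsymmx /\
  forall x : 'cV[R[i]]_n, x != 0 -> 0 < (x^t* *m M *m x) 0 0.

Definition loewner_gt M N : Prop := posdefmx (M - N).

(* For the two coefficients the last branch is the case eta = +oo; the sets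
   below are only meant for 1 < eta, which excludes -oo. *)
Definition stein_coef eta : R :=
  if eta is r%:E then (r - 1) / (r + 1) else 1.

Definition inv_coef eta : R :=
  if eta is r%:E then r^-1 else 0.

Definition stein_set H eta : set 'M[R[i]]_n :=
  [set A | loewner_gt ((stein_coef eta)%:C *: H - A^t* *m H *m A) 0].

Definition lyapunov_set H eta : set 'M[R[i]]_n :=
  [set A | loewner_gt (H *m A + A^t* *m H)
                      ((inv_coef eta)%:C *: (A^t* *m H *m A + H))].

(* [eigenvalue] is phrased with row (left) eigenvectors, which gives the usual
   spectrum of a square matrix. *)
Definition spec A : set R[i] := [set z | eigenvalue A z].

(* [invmx] is total; this is the Cayley transform only when -1 is not in
   [spec A]. *)
Definition cayley A : 'M[R[i]]_n := (1%:M - A) *m invmx (1%:M + A).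

Definition cayley_dom : set 'M[R[i]]_n := [set A | ~ spec A (-1)].

End Disks.

(* Main.v *)
(* Put [M = 1 + A], [N = 1 - A] and [c = 1 / eta], so that [B = cayley A]
   satisfies [B M = N].  The congruence by the invertible matrix [M] takes
   [H B + B^* H - c (B^* H B + H)] to
   [M^* H N + N^* H M - c (N^* H N + M^* H M)
      = 2 (1 + c) ((1 - c) / (1 + c) H - A^* H A)],
   and [(1 - c) / (1 + c) = (eta - 1) / (eta + 1)].  Hence [A] is in the Stein
   set iff [B] is in the Lyapunov set; moreover [1 + B = 2 M^-1], so the Cayley
   transform is an involution of its domain. *)

Require Import Defs.
From mathcomp Require Import all_boot all_order all_algebra.
From mathcomp Require Import sesquilinear spectral complex.
From mathcomp Require Import classical_sets reals constructive_ereal.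
From mathcomp Require Import ring lra.

Import Order.TTheory GRing.Theory Num.Theory.

Local Open Scope ring_scope.
Local Open Scope complex_scope.
Local Open Scope sesquilinear_scope.
Local Open Scope classical_set_scope.

(* [A'] and [B'] stand for the adjoints of [A] and [B = cayley A], [c] for
   [1 / eta] and [s] for [(eta - 1) / (eta + 1)]. *)
Lemma cayley_congruence (K : comPzRingType) n (H A A' B B' : 'M[K]_n)
    (c s : K) :
  B *m (1%:M + A) = 1%:M - A -> (1%:M + A') *m B' = 1%:M - A' ->
  (1 + c) * s = 1 - c ->
  (1%:M + A') *m (H *m B + B' *m H - c *: (B' *m H *m B + H)) *m (1%:M + A) =
  (2 * (1 + c)) *: (s *: H - A' *m H *m A).
Proof.
move=> BM MB cs.
(* The outer factors are absorbed through [BM] and [MB], so that [B] and [B'] disappear. *)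
have -> : (1%:M + A') *m (H *m B + B' *m H - c *: (B' *m H *m B + H))
      *m (1%:M + A) =
    (1%:M + A') *m H *m (1%:M - A) + (1%:M - A') *m H *m (1%:M + A)
    - c *: ((1%:M - A') *m H *m (1%:M - A) + (1%:M + A') *m H *m (1%:M + A)).
  (* Abstracting the two sums keeps distributivity from splitting them. *)
  rewrite -BM -MB; move: (1%:M + A) (1%:M + A') => P Q.
  rewrite mulmxBr mulmxBl -scalemxAr -scalemxAl.
  by rewrite !mulmxDr !mulmxDl !mulmxA.
rewrite scalerBr scalerA -mulrA cs.
rewrite !(mulmxDl, mulmxDr, mulmxBl, mulmxBr, mulNmx, mulmxN).
rewrite !(mul1mx, mulmx1).
by apply/matrixP => i j; rewrite !mxE; ring.
Qed.

Section CayleyTransform.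
Context {R : realType} {n : nat}.
Implicit Types A B H M X : 'M[R[i]]_n.

Lemma adjmxM m p q (A : 'M[R[i]]_(m, p)) (B : 'M[R[i]]_(p, q)) :
  (A *m B)^t* = B^t* *m A^t*.
Proof. by rewrite trmx_mul map_mxM. Qed.

Lemma hermsymmxE X : (X \is hermsymmx) = (X == X^t*).
Proof. by rewrite is_hermitianmxE expr0 scale1r. Qed.

Lemma posdefmx_congr M X : M \in unitmx -> posdefmx X ->
  posdefmx (M^t* *m X *m M).
Proof.
move=> Mu [Xherm Xpos]; split=> [|x x0].
  rewrite hermsymmxE !adjmxM trmxCK -mulmxA.
  by move: Xherm; rewrite hermsymmxE => /eqP <-.
have Mx0 : M *m x != 0.
  by apply: contra_neq x0 => Mx; rewrite -[x](mulKmx Mu) Mx mulmx0.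
by have := Xpos _ Mx0; rewrite adjmxM !mulmxA.
Qed.

(** The converse is the congruence by [invmx M], which undoes the one by [M]. *)
Lemma posdefmx_congr_iff M X : M \in unitmx ->
  posdefmx (M^t* *m X *m M) <-> posdefmx X.
Proof.
move=> Mu; split=> [P|]; last exact: posdefmx_congr.
have Vu : invmx M \in unitmx by rewrite unitmx_inv.
have := posdefmx_congr _ _ Vu P.
rewrite !mulmxA -(adjmxM _ _ _ M) (mulmxV Mu) trmx1 map_mx1 mul1mx.
by rewrite (mulmxK Mu).
Qed.

Lemma posdefmxZ (k : R) X : 0 < k -> posdefmx X -> posdefmx (k%:C *: X).
Proof.
move=> k0 [Xherm Xpos]; split=> [|x x0].
  rewrite hermsymmxE linearZ /= map_mxZ.
  move: Xherm; rewrite hermsymmxE => /eqP <-.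
  (* A real scalar is fixed by conjugation. *)
  by rewrite /= conj_Creal // complex_real.
rewrite -scalemxAr -scalemxAl mxE mulr_gt0 ?Xpos //.
by rewrite ltcR.
Qed.

Lemma posdefmxZ_iff (k : R) X : 0 < k ->
  posdefmx (k%:C *: X) <-> posdefmx X.
Proof.
move=> k0; split=> [P|]; last exact: posdefmxZ.
have kV0 : 0 < k^-1 by rewrite invr_gt0.
have := posdefmxZ _ _ kV0 P.
rewrite scalerA -(rmorphM (real_complex R)) mulVf; last by rewrite gt_eqF.
by rewrite rmorph1 scale1r.
Qed.

(** The eigenspace for -1 is the kernel of [A + 1], which is zero exactly when this square matrix is
    invertible. *)
Lemma cayley_domE A : cayley_dom A <-> 1%:M + A \in unitmx.
Proof.
rewrite /cayley_dom /spec /= /eigenvalue /eigenspace kermx_eq0 row_free_unit.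
rewrite rmorphN opprK addrC.
by split=> [/negP/negPn|->].
Qed.

Lemma cayley_mul A : cayley_dom A -> cayley A *m (1%:M + A) = 1%:M - A.
Proof. by move=> /cayley_domE Mu; rewrite mulmxKV. Qed.

(** Multiplied on the right by [1 + A], the left side becomes [(1 + A) + (1 - A) = 2]. *)
Lemma add1_cayley A : cayley_dom A ->
  1%:M + cayley A = 2 *: invmx (1%:M + A).
Proof.
move=> Ad; have /cayley_domE Mu := Ad.
apply: (can_inj (mulmxK Mu)).
rewrite mulmxDl cayley_mul // mul1mx -scalemxAl mulVmx //.
by rewrite addrACA subrr addr0 scaler_nat mulr2n.
Qed.

Lemma cayley_dom_cayley A : cayley_dom A -> cayley_dom (cayley A).
Proof.
move=> Ad; have /cayley_domE Mu := Ad.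
apply/cayley_domE; rewrite add1_cayley // unitmxZ ?unitmx_inv //.
by rewrite unitfE pnatr_eq0.
Qed.

Lemma cayleyK A : cayley_dom A -> cayley (cayley A) = A.
Proof.
move=> Ad; have /cayley_domE Mu := Ad.
have /cayley_domE Cu := cayley_dom_cayley _ Ad.
(* Cancelling [1 + cayley A] and then [1 + A] on the right leaves [(1 + A) - (1 - A) = 2 A]. *)
apply: (can_inj (mulmxK Cu)); rewrite cayley_mul; last exact: cayley_dom_cayley.
apply: (can_inj (mulmxK Mu)); rewrite mulmxBl cayley_mul // mul1mx.
rewrite add1_cayley // -scalemxAr -scalemxAl mulmxKV //.
by apply/matrixP => i j; rewrite !mxE; ring.
Qed.

End CayleyTransform.

Lemma stein_inv_coef (R : realType) (eta : \bar R) : (1 < eta)%E ->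
  0 < 1 + inv_coef eta /\
  (1 + inv_coef eta) * stein_coef eta = 1 - inv_coef eta.
Proof.
(* At infinity the coefficients are 0 and 1; the case of minus infinity contradicts [1 < eta]. *)
case: eta => [r||] //=; last by rewrite addr0 subr0 mulr1.
rewrite lte_fin => r1; have r0 : 0 < r by lra.
split; first by rewrite addr_gt0 ?invr_gt0.
by field; rewrite !gt_eqF //; lra.
Qed.

Lemma stein_lyapunov_cayley (R : realType) (n : nat) (H A : 'M[R[i]]_n)
    (eta : \bar R) : (1 < eta)%E -> cayley_dom A ->
  stein_set H eta A <-> lyapunov_set H eta (cayley A).
Proof.
move=> eta1 Ad; have /cayley_domE Mu := Ad.
have [c0 ceq] := stein_inv_coef _ _ eta1.
rewrite /stein_set /lyapunov_set /= /loewner_gt subr0.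
have k0 : 0 < 2 * (1 + inv_coef eta) by rewrite mulr_gt0.
(* Scale the Stein form by [2 (1 + c) > 0], with [c = inv_coef eta], and apply the congruence by
   [1 + A] to the Lyapunov form; the two then coincide. *)
apply: (iff_trans (iff_sym (posdefmxZ_iff _ _ k0))).
apply: (iff_trans _ (posdefmx_congr_iff _ _ Mu)).
have Mt : (1%:M + A)^t* = 1%:M + A^t*.
  by rewrite linearD /= map_mxD trmx1 map_mx1.
have BM := cayley_mul _ Ad.
have MB : (1%:M + A^t*) *m (cayley A)^t* = 1%:M - A^t*.
  by rewrite -Mt -adjmxM BM linearB /= map_mxB trmx1 map_mx1.
have cs : (1 + (inv_coef eta)%:C) * (stein_coef eta)%:C
    = 1 - (inv_coef eta)%:C.
  by rewrite -(rmorph1 (real_complex R)) -rmorphB -rmorphD -rmorphM ceq.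
rewrite Mt (cayley_congruence _ _ _ _ _ _ _ _ _ BM MB cs).
by rewrite !mulr_natl -(rmorph1 (real_complex R)) -rmorphD -rmorphMn.
Qed.

Theorem proposition5p1 (R : realType) (n : nat) (H : 'M[R[i]]_n)
    (eta : \bar R) (H_herm : H \is hermsymmx) (H_unit : H \in unitmx)
    (eta_gt1 : (1 < eta)%E) :
  cayley @` (stein_set H eta `&` cayley_dom) =
  lyapunov_set H eta `&` cayley_dom.
Proof.
apply/seteqP; split=> [_ [A [SA Ad] <-]|B [LB Bd]].
  have [SL _] := stein_lyapunov_cayley _ _ H A _ eta_gt1 Ad.
  by split; [exact: SL | exact: cayley_dom_cayley].
(* By involutivity, [cayley B] is a preimage of [B]. *)
have Cd := cayley_dom_cayley _ Bd; exists (cayley B); last exact: cayleyK.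
have [_ LS] := stein_lyapunov_cayley _ _ H _ _ eta_gt1 Cd.
by split; first by apply: LS; rewrite cayleyK.
Qed.
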